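(* Consider a line network with nodes $V=\{1,\dots,N\}$, $N\ge 2$, and links $E=\{(1,2),(2,3),\dots,(N-1,N)\}$, carrying a single unicast flow from source node $1$ to destination node $N$, with all nodes $2,\dots,N-1$ forwarding updates, under general interference constraints. Let $\pi$ be a stationary randomized policy whose link activation frequency for link $e$ is $f_e>0$ for every $e\in E$, and let $\gamma_e$ be the channel state probability of link $e$. Then the average age at node $N$ under $\pi$ is $$\lim_{T\to\infty}\mathbb{E}\left[\frac1T\sum_{t=1}^{T}A_N(t)\right]=\sum_{e\in E}\frac{1}{\gamma_e f_e}.$$
   Context: Time is slotted, $t=1,2,\dots$. Write $e_j=(j-1,j)$ for $j=2,\dots,N$. Channel: $S_{e}(t)\in\{0,1\}$ is the state of link $e$ at time $t$; the variables $S_e(t)$ are independent over links $e$ and i.i.d. over time, with $\gamma_e=\mathbb{P}[S_e(t)=1]\in(0,1]$. Interference: there is a finite collection $\mathcal{A}$ of feasible actions; here each $m\in\mathcal{A}$ is a set of links on which updates may be transmitted simultaneously without interference. In every slot an action in $\mathcal{A}$ is chosen; $U_e(t)=1$ if link $e$ is scheduled (belongs to the chosen action) at time $t$, and $U_e(t)=0$ otherwise. Age: $A_j(t)$ is the age of the freshest update held by node $j$. The source always has fresh information, so $A_1(t)=0$ for all $t$. For $j=2,\dots,N$, $$A_j(t+1)=\begin{cases}\min(A_j(t),A_{j-1}(t))+1 & \text{if } U_{e_j}(t)S_{e_j}(t)=1,\\ A_j(t)+1 & \text{if } U_{e_j}(t)S_{e_j}(t)=0,\end{cases}$$ with fixed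 finite initial ages $A_j(1)$. Stationary randomized policy: given probabilities $(x_m)_{m\in\mathcal{A}}$, $x_m\ge0$, $\sum_{m}x_m=1$, in each slot the action $m\in\mathcal{A}$ is chosen with probability $x_m$, independently across time slots and independently of the channel states. Its link activation frequencies are $f_e=\sum_{m\in\mathcal{A}:\,e\in m}x_m=\mathbb{P}[U_e(t)=1]$. *)

(* Defs.v *)
From HB Require Import structures.
From mathcomp Require Import all_boot all_order all_algebra.
From mathcomp Require Import all_classical all_reals all_analysis.

Set Implicit Arguments.
Unset Strict Implicit.
Unset Printing Implicit Defensive.

Import Order.TTheory GRing.Theory Num.Theory.
Import numFieldNormedType.Exports.

Local Open Scope classical_set_scope.
Local Open Scope ring_scope.

(* Nodes are the naturals 1, ..., N.  The ordinal i : link N stands for the link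
   (i + 1, i + 2), so that (1, 2), ..., (N - 1, N) are numbered from 0. *)
Definition link (N : nat) : finType := 'I_N.-1.

Definition link_src (N : nat) (e : link N) : nat := e.+1.

Definition link_dst (N : nat) (e : link N) : nat := e.+2.

(* An action is the set of links it activates. *)
Definition action (N : nat) : finType := {set link N}.

(* The sigma-algebra generated by X; all subsets of F are taken, so this is
   meant for random variables with values in a finite (discrete) type. *)
Definition sigma_of (Omega F : Type) (X : Omega -> F) : set (set Omega) :=
  [set X @^-1` B | B in [set: set F]].

Definition mutually_independent (d : measure_display) (Omega : measurableType d)
    (R : realType) (P : probability Omega R) (I : choiceType)
    (G : I -> set (set Omega)) : Prop :=
  forall (J : seq I) (B : I -> set Omega), uniq J ->
    (forall i, i \in J -> G i (B i)) ->
    P (\bigcap_(i in [set` J]) B i) = (\prod_(i <- J) P (B i))%E.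

(* Slots are t = 1, 2, ...; values at t = 0 are never constrained. *)
Record channel_process (d : measure_display) (Omega : measurableType d)
    (R : realType) (P : probability Omega R) (N : nat) (gamma : link N -> R)
    (S : link N -> nat -> Omega -> bool) : Prop := ChannelProcess {
  channel_measurable : forall e t, (1 <= t)%N ->
    sigma_of (S e t) `<=` measurable ;
  channel_prob : forall e t, (1 <= t)%N ->
    P [set w | S e t w = true] = (gamma e)%:E }.

Record action_process (d : measure_display) (Omega : measurableType d)
    (R : realType) (P : probability Omega R) (N : nat) (Act : {set action N})
    (x : action N -> R) (M : nat -> Omega -> action N) : Prop := ActionProcess {
  action_measurable : forall t, (1 <= t)%N -> sigma_of (M t) `<=` measurable ;
  action_feasible : forall t w, (1 <= t)%N -> M t w \in Act ;
  action_prob : forall t m, (1 <= t)%N -> m \in Act ->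
    P [set w | M t w = m] = (x m)%:E }.

(* The index inl (e, k) stands for the state of link e in slot k + 1, and inr k
   for the action chosen in slot k + 1. *)
Definition slot_sigma (Omega : Type) (N : nat)
    (S : link N -> nat -> Omega -> bool) (M : nat -> Omega -> action N)
    (i : (link N * nat) + nat) : set (set Omega) :=
  match i with
  | inl (e, k) => sigma_of (S e k.+1)
  | inr k => sigma_of (M k.+1)
  end.

Definition activation_frequency (R : realType) (N : nat) (Act : {set action N})
    (x : action N -> R) (e : link N) : R :=
  \sum_(m in Act | e \in m) x m.

(* A j t w is the age at node j in slot t; U_e(t) = 1 reads e \in M t w. *)
Record age_process (Omega : Type) (R : realType) (N : nat)
    (S : link N -> nat -> Omega -> bool) (M : nat -> Omega -> action N)
    (a0 : nat -> R) (A : nat -> nat -> Omega -> R) : Prop := AgeProcess {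
  age_source : forall t w, (1 <= t)%N -> A 1%N t w = 0 ;
  age_init : forall j w, (2 <= j <= N)%N -> A j 1%N w = a0 j ;
  age_step : forall (e : link N) t w, (1 <= t)%N ->
    A (link_dst e) t.+1 w =
      if (e \in M t w) && S e t w
      then Num.min (A (link_dst e) t w) (A (link_src e) t w) + 1
      else A (link_dst e) t w + 1 }.

(* Main.v *)
(* Whether link e_j delivers in slot t is independent of the history up to slot t, with
   probability p_j = gamma f. Averaging the recursion gives
     E A_j(t+1) = (1 - p_j) E A_j(t) + p_j E min(A_j(t), A_(j-1)(t)) + 1.
   The minimum is A_(j-1)(t) except while node j is fresher than its predecessor, which can
   only happen while it holds its initial information, so that A_j(t) = A_j(1) + t - 1. The expected gap
   A_(j-1)(t) - min(A_j(t), A_(j-1)(t)) is then O(1/t) by a Markov-type bound. Induction on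
   j gives E A_j(t) --> E A_(j-1)(oo) + 1/p_j, and the time average follows by Cesaro. *)
Require Import Defs.
From HB Require Import structures.
From mathcomp Require Import all_boot all_order all_algebra.
From mathcomp Require Import all_classical all_reals all_analysis.
From mathcomp Require Import measurable_realfun lra.
Import Order.TTheory GRing.Theory Num.Theory.
Import numFieldNormedType.Exports.
Local Open Scope classical_set_scope.
Local Open Scope ring_scope.

(** * Affine recurrences with convergent forcing *)

(** Each step contracts the distance of [u] to [l] by the factor [1 - p] and adds the distance of
    [v] to [p * l]. The initial error therefore dies out geometrically, and the accumulated forcing
    error stays small. *)
Lemma cvg_affine_recurrence (R : realType) (p l : R) (u v : nat -> R) :
  0 < p <= 1 -> (forall n, u n.+1 = (1 - p) * u n + v n) ->
  v @ \oo --> p * l -> u @ \oo --> l.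
Proof.
move=> /andP[p0 p1] hu hv; apply/cvgrPdist_le => eps eps0.
have q0 : 0 <= 1 - p by lra.
have q1 : `|1 - p| < 1 by rewrite ger0_norm//; lra.
(* The tolerance [p * (eps / 2)] is chosen because [eps / 2] is the fixed point of
   [y |-> (1 - p) * y + p * (eps / 2)], so the bound below is preserved by each step. *)
move/cvgrPdist_le : hv => /(_ (p * (eps / 2))) []; first by rewrite mulr_gt0//; lra.
move=> m _ hm.
have bnd k : `|l - u (m + k)%N| <= (1 - p) ^+ k * `|l - u m| + eps / 2.
  elim: k => [|k IH]; first by rewrite addn0 expr0 mul1r; lra.
  have -> : l - u (m + k.+1)%N = (1 - p) * (l - u (m + k)%N) + (p * l - v (m + k)%N).
    by rewrite addnS hu; lra.
  apply: (le_trans (ler_normD _ _)); rewrite normrM (ger0_norm q0) exprS.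
  have := hm (m + k)%N (leq_addr _ _); have := ler_wpM2l q0 IH; rewrite /=; lra.
have : (fun k => (1 - p) ^+ k * `|l - u m|) @ \oo --> (0 : R).
  by rewrite -[X in _ --> X](mul0r `|l - u m|); apply: cvgMl; apply: cvg_expr.
move=> /cvgrPdist_le /(_ (eps / 2)) []; first by lra.
move=> k _ hk; exists (m + k)%N => // n /= hn.
have km : (k <= n - m)%N by rewrite leq_subRL// (leq_trans _ hn)// leq_addr.
have := hk _ km; rewrite /= sub0r normrN ger0_norm; last first.
  by rewrite mulr_ge0// exprn_ge0.
have := bnd (n - m)%N; rewrite subnKC ?(leq_trans _ hn)// ?leq_addr//; lra.
Qed.

(** * Expectations of random variables that factor through a finite type *)

Section FiniteVariables.
Context {R : realType} {d : measure_display} {Omega : measurableType d}.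
Context (P : probability Omega R).
Implicit Types X Y : Omega -> R.

Definition measurable_fibers {K : finType} (H : Omega -> K) : Prop :=
  forall h, measurable (H @^-1` [set h]).

Definition determined_by {K : Type} {V : Type} (H : Omega -> K) (X : Omega -> V) : Prop :=
  forall w w', H w = H w' -> X w = X w'.

(** Being a function of a finite measurable observation gives integrability at once, turns
    expectations into finite sums, and is stable under arbitrary pointwise operations, since two
    observations can be paired. *)
Definition simple_variable X : Prop :=
  exists (K : finType) (H : Omega -> K), measurable_fibers H /\ determined_by H X.

(** Real-valued, so that the age recursion can be averaged by ordinary algebra; for simple variables
    [fine] loses nothing, by [expectation_mean]. *)
Definition mean X : R := fine ('E_P[X])%E.

Lemma determined_by_factor (K : finType) (H : Omega -> K) X :
  determined_by H X -> exists c : K -> R, X = c \o H.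
Proof.
move=> HX; suff /choice[c hc] : forall h, exists r : R, forall w, H w = h -> X w = r.
  by exists c; apply/funext => w /=; exact: hc.
move=> h; have [[w hw]|no] := pselect (exists w, H w = h).
  by exists (X w) => w' hw'; apply: HX; rewrite hw hw'.
(* Off the range of [H] the factor is arbitrary. *)
by exists 0 => w hw; case: no; exists w.
Qed.

Lemma sum_fibers (K : finType) (H : Omega -> K) (c : K -> R) :
  c \o H = (fun w => \sum_h c h * \1_(H @^-1` [set h]) w).
Proof.
apply/funext => w /=; rewrite (bigD1 (H w))//= big1 ?addr0.
  by rewrite indicE mem_set// mulr1.
move=> h hh; rewrite indicE memNset ?mulr0//= => E.
by rewrite E eqxx in hh.
Qed.

Lemma integrable_scaled_indic (k : R) (B : set Omega) : measurable B ->
  P.-integrable setT (fun w => (k * \1_B w)%:E).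
Proof.
move=> mB; apply: (@measurable_bounded_integrable _ _ _ _ (fun w => k * \1_B w)) => //.
- by rewrite (le_lt_trans (probability_le1 _ _)) ?ltry.
- by apply: measurable_funM => //; exact: measurable_indic.
- exists `|k|; split => // M hM w _ /=; rewrite (le_trans _ (ltW hM))//.
  by rewrite indicE; case: (_ \in _); rewrite ?mulr1 ?mulr0 ?normr0.
Qed.

Lemma simple_variable_Lfun1 X : simple_variable X -> X \in Lfun P 1.
Proof.
move=> [K [H [mH /determined_by_factor[c ->]]]].
apply/Lfun1_integrable; rewrite sum_fibers.
rewrite (_ : _ \o _ = fun w => (\sum_h (c h * \1_(H @^-1` [set h]) w)%:E)%E).
  by apply: integrable_sum => // h _; exact: integrable_scaled_indic.
by apply/funext => w /=; rewrite sumEFin.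
Qed.

Lemma expectation_mean X : simple_variable X -> ('E_P[X])%E = (mean X)%:E.
Proof.
by move=> sX; rewrite /mean fineK// expectation_fin_num// simple_variable_Lfun1.
Qed.

Lemma mean_factor (K : finType) (H : Omega -> K) (c : K -> R) :
  measurable_fibers H ->
  mean (c \o H) = \sum_h c h * fine (P (H @^-1` [set h])).
Proof.
move=> mH; rewrite /mean unlock sum_fibers.
under eq_integral do rewrite -sumEFin.
rewrite integral_sum//; last by move=> h; exact: integrable_scaled_indic.
rewrite (eq_bigr (fun h => (c h * fine (P (H @^-1` [set h])))%:E)) ?sumEFin//.
move=> h _; under eq_integral do rewrite EFinM.
rewrite integralZl//; last first.
  by under eq_fun do rewrite -[\1_ _ _]mul1r; exact: integrable_scaled_indic.
by rewrite integral_indic// setIT EFinM fineK// fin_num_measure.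
Qed.

Lemma measurable_fibers_pair (K L : finType) (H : Omega -> K) (G : Omega -> L) :
  measurable_fibers H -> measurable_fibers G ->
  measurable_fibers (fun w => (H w, G w)).
Proof.
move=> mH mG [h g]; rewrite (_ : _ @^-1` _ = H @^-1` [set h] `&` G @^-1` [set g]).
  exact: measurableI.
by apply/seteqP; split => w /= [] // -> ->.
Qed.

Lemma simple_variable_comp2 (f : R -> R -> R) X Y :
  simple_variable X -> simple_variable Y -> simple_variable (fun w => f (X w) (Y w)).
Proof.
move=> [K [H [mH HX]]] [L [G [mG GY]]].
exists _, (fun w => (H w, G w)); split; first exact: measurable_fibers_pair.
by move=> w w' [/HX -> /GY ->].
Qed.

Lemma simple_variable_comp (f : R -> R) X :
  simple_variable X -> simple_variable (f \o X).
Proof. by move=> sX; apply: (@simple_variable_comp2 (fun x _ => f x) X X). Qed.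

Lemma meanD X Y : simple_variable X -> simple_variable Y ->
  mean (X \+ Y) = mean X + mean Y.
Proof.
move=> sX sY; rewrite {1}/mean expectationD ?simple_variable_Lfun1//.
by rewrite !expectation_mean.
Qed.

Lemma meanZ (k : R) X : simple_variable X -> mean (fun w => k * X w) = k * mean X.
Proof.
move=> sX; rewrite {1}/mean (_ : (fun _ => _) = k \o* X); last first.
  by apply/funext => w /=; rewrite mulrC.
by rewrite expectationZl ?simple_variable_Lfun1// expectation_mean.
Qed.

Lemma meanB X Y : simple_variable X -> simple_variable Y ->
  mean (X \- Y) = mean X - mean Y.
Proof.
move=> sX sY; rewrite {1}/mean expectationB ?simple_variable_Lfun1//.
by rewrite !expectation_mean.
Qed.

Lemma mean_cst (k : R) : mean (fun=> k) = k.
Proof. by rewrite /mean expectation_cst. Qed.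

Lemma mean_ge0 X : (forall w, 0 <= X w) -> 0 <= mean X.
Proof. by move=> X0; apply/fine_ge0/expectation_ge0. Qed.

Lemma ler_mean X Y : simple_variable X -> simple_variable Y ->
  (forall w, X w <= Y w) -> mean X <= mean Y.
Proof.
move=> sX sY XY; rewrite -subr_ge0 -meanB//; apply: mean_ge0 => w /=.
by rewrite subr_ge0.
Qed.

Lemma simple_variable_cst (k : R) : simple_variable (fun=> k).
Proof.
exists unit, (fun=> tt); split => // h.
rewrite (_ : _ @^-1` _ = setT)//.
by apply/seteqP; split => // w _ /=; case: h.
Qed.

Lemma simple_variable_sum (F : nat -> Omega -> R) (s : seq nat) :
  (forall i, i \in s -> simple_variable (F i)) ->
  simple_variable (fun w => \sum_(i <- s) F i w).
Proof.
elim: s => [_|i s IH sF].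
  by under eq_fun do rewrite big_nil; exact: simple_variable_cst.
under eq_fun do rewrite big_cons.
apply: (simple_variable_comp2 +%R); first by apply: sF; rewrite mem_head.
by apply: IH => j js; apply: sF; rewrite inE js orbT.
Qed.

Lemma mean_sum (F : nat -> Omega -> R) (s : seq nat) :
  (forall i, i \in s -> simple_variable (F i)) ->
  mean (fun w => \sum_(i <- s) F i w) = \sum_(i <- s) mean (F i).
Proof.
elim: s => [_|i s IH sF].
  by rewrite big_nil; under eq_fun do rewrite big_nil; exact: mean_cst.
under eq_fun do rewrite big_cons.
have sFs j : j \in s -> simple_variable (F j).
  by move=> js; apply: sF; rewrite inE js orbT.
rewrite big_cons -(IH sFs); apply: meanD; first by apply: sF; rewrite mem_head.
exact: simple_variable_sum.
Qed.

End FiniteVariables.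

(** * The finite history and its independence from the next slot *)

(** Index [k] stands for slot [k + 1], so this records slots 1 to [n], which is all that the ages in
    slot [n + 1] depend on. Its type is finite. *)
Definition history {Omega : Type} {N : nat} (S : link N -> nat -> Omega -> bool)
    (M : nat -> Omega -> action N) (n : nat) (w : Omega) :
    {ffun link N * 'I_n -> bool} * {ffun 'I_n -> action N} :=
  ([ffun ek : link N * 'I_n => S ek.1 ek.2.+1 w], [ffun k : 'I_n => M k.+1 w]).

Section History.
Context {R : realType} {d : measure_display} {Omega : measurableType d}.
Context {P : probability Omega R} {N : nat} {gamma : link N -> R}.
Context {Act : {set action N}} {x : action N -> R}.
Context {S : link N -> nat -> Omega -> bool} {M : nat -> Omega -> action N}.
Context (hS : channel_process P gamma S).
Context (hM : action_process P Act x M).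
Context (hindep : mutually_independent P (slot_sigma S M)).

Lemma historyP (n : nat) (w w' : Omega) :
  history S M n w = history S M n w' <->
  forall k, (k < n)%N -> (forall e, S e k.+1 w = S e k.+1 w') /\ M k.+1 w = M k.+1 w'.
Proof.
split=> [[/ffunP ES /ffunP EM] k kn|E].
  split=> [e|]; first by have := ES (e, Ordinal kn); rewrite !ffunE.
  by have := EM (Ordinal kn); rewrite !ffunE.
rewrite /history; congr (_, _); apply/ffunP; [move=> [e k]|move=> k]; rewrite !ffunE /=.
  exact: (proj1 (E k (ltn_ord k))).
exact: (proj2 (E k (ltn_ord k))).
Qed.

Definition slots (n : nat) : seq (link N * nat + nat) :=
  [seq inl (e, k) | e <- enum (link N), k <- iota 0 n] ++ [seq inr k | k <- iota 0 n].

Lemma mem_slots_inl n e k : (inl (e, k) \in slots n) = (k < n)%N.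
Proof.
rewrite mem_cat; apply/orP/idP => [[/allpairsP[[e' k'] /= []]|/mapP[]//]|kn].
  by rewrite mem_iota add0n => _ /andP[_ kn] [_ ->].
by left; apply/allpairsP; exists (e, k); rewrite /= mem_enum mem_iota.
Qed.

Lemma mem_slots_inr n k : (inr k \in slots n) = (k < n)%N.
Proof.
rewrite mem_cat; apply/orP/idP => [[/allpairsP[[e' k'] /= []]//|/mapP[k' /=]]|kn].
  by rewrite mem_iota add0n => /andP[_ kn] [->].
by right; rewrite map_f// mem_iota.
Qed.

Lemma slots_uniq n : uniq (slots n).
Proof.
rewrite cat_uniq; apply/and3P; split.
- rewrite allpairs_uniq ?enum_uniq ?iota_uniq//.
  by move=> [e k] [e' k'] _ _ /= [-> ->].
- by apply/hasPn => _ /mapP[k _ ->]; apply/negP => /allpairsP[? []].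
- by rewrite map_inj_uniq ?iota_uniq// => k k' [].
Qed.

(** The prescribed outcomes [s] and [m] are total functions of the index, so that one family of
    events can be intersected over any finite set of slots. *)
Definition slot_event (s : link N -> nat -> bool) (m : nat -> action N)
    (i : link N * nat + nat) : set Omega :=
  match i with
  | inl (e, k) => S e k.+1 @^-1` [set s e k]
  | inr k => M k.+1 @^-1` [set m k]
  end.

Lemma slot_event_sigma s m i : slot_sigma S M i (slot_event s m i).
Proof. by case: i => [[e k]|k] /=; [exists [set s e k]|exists [set m k]]. Qed.

Lemma measurable_slot_event s m i : measurable (slot_event s m i).
Proof.
have := slot_event_sigma s m i; case: i => [[e k]|k].
  exact: (channel_measurable hS).
exact: (action_measurable hM).
Qed.

Lemma history_fiber n w0 s m :
  (forall k, (k < n)%N -> (forall e, s e k = S e k.+1 w0) /\ m k = M k.+1 w0) ->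
  history S M n @^-1` [set history S M n w0] =
  \bigcap_(i in [set` slots n]) slot_event s m i.
Proof.
move=> sm; apply/seteqP; split=> w /=.
  move/historyP => E [[e k]|k] /=; rewrite ?mem_slots_inl ?mem_slots_inr => kn.
    by rewrite (proj1 (sm k kn)) (proj1 (E k kn)).
  by rewrite (proj2 (sm k kn)) (proj2 (E k kn)).
move=> E; apply/historyP => k kn; split=> [e|].
  by rewrite -(proj1 (sm k kn)); apply: (E (inl (e, k))); rewrite /= mem_slots_inl.
by rewrite -(proj2 (sm k kn)); apply: (E (inr k)); rewrite /= mem_slots_inr.
Qed.

Lemma measurable_fibers_history n : measurable_fibers (history S M n).
Proof.
move=> h; have [[w0 <-]|no] := pselect (exists w, history S M n w = h); last first.
  rewrite (_ : _ @^-1` _ = set0)//; apply/seteqP; split=> // w /= hw.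
  by case: no; exists w.
rewrite (@history_fiber n w0 (fun e k => S e k.+1 w0) (fun k => M k.+1 w0))//.
by apply: fin_bigcap_measurable => [|i _]; [exact: finite_seq|]; exact: measurable_slot_event.
Qed.

(** A nonempty fiber of the history is an intersection of elementary slot events, and the joint
    event only adds two new indices. Mutual independence is applied once to each intersection, and
    the two products are compared. *)
Lemma history_slot_independent n e h m b :
  P ((fun w => (history S M n w, (M n.+1 w, S e n.+1 w))) @^-1` [set (h, (m, b))]) =
  (P (history S M n @^-1` [set h]) *
   (P (M n.+1 @^-1` [set m]) * P (S e n.+1 @^-1` [set b])))%E.
Proof.
have [[w0 <-]|no] := pselect (exists w, history S M n w = h); last first.
  rewrite (_ : history S M n @^-1` _ = set0); last first.
    by apply/seteqP; split=> // w /= hw; case: no; exists w.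
  rewrite (_ : _ @^-1` _ = set0) ?measure0 ?mul0e//.
  by apply/seteqP; split=> // w /= [hw _]; case: no; exists w.
(* The outcome seen at [w0] is prolonged by [b] and [m] from index [n] on. Only the values at
   [inl (e, n)] and [inr n] matter there, so [b] may be given to every link. *)
pose s e' k := if (k < n)%N then S e' k.+1 w0 else b.
pose mm k := if (k < n)%N then M k.+1 w0 else m.
have sm k : (k < n)%N -> (forall e, s e k = S e k.+1 w0) /\ mm k = M k.+1 w0.
  by rewrite /s /mm => ->.
have snn : s e n = b by rewrite /s ltnn.
have mnn : mm n = m by rewrite /mm ltnn.
rewrite (history_fiber n w0 s mm sm) hindep ?slots_uniq//; last first.
  by move=> i _; exact: slot_event_sigma.
have -> : (fun w => (history S M n w, (M n.+1 w, S e n.+1 w))) @^-1`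
      [set (history S M n w0, (m, b))] =
    \bigcap_(i in [set` inr n :: inl (e, n) :: slots n]) slot_event s mm i.
  rewrite bigcap_seq !big_cons -bigcap_seq -(history_fiber n w0 s mm sm) /= snn mnn.
  (* With the history abstract, the equation between triples splits into exactly three equations. *)
  move: (history S M n) => H.
  by apply/seteqP; split=> w /=; [move=> [-> -> ->]|move=> [-> [-> ->]]].
rewrite hindep; last 2 first.
- by rewrite /= inE /= mem_slots_inl mem_slots_inr ltnn slots_uniq.
- by move=> i _; exact: slot_event_sigma.
by rewrite !big_cons /= snn mnn muleA muleC.
Qed.

(** The law of the action is prescribed by [x] on [Act] only. An action outside [Act] has an empty
    fiber by feasibility, so summing over all sets of links adds nothing. *)
Lemma activation_probability n (e : link N) :
  \sum_(m : action N) (e \in m)%:R * fine (P (M n.+1 @^-1` [set m])) =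
  activation_frequency Act x e.
Proof.
rewrite /activation_frequency [RHS]big_mkcond; apply: eq_bigr => m _.
have [mA|mA] := boolP (m \in Act); case: (e \in m); rewrite /= ?mul0r ?mul1r//.
  by rewrite (_ : _ @^-1` _ = [set w | M n.+1 w = m])// (action_prob hM).
rewrite (_ : _ @^-1` _ = set0) ?measure0//.
apply/seteqP; split=> // w /= E.
by move: (action_feasible hM w (ltn0Sn n)); rewrite E (negbTE mA).
Qed.

(** The probabilities of the triples (history, action, channel state) factor, and so does the
    integrand. The triple sum is thus a product of three sums, equal to the mean of [X], the
    activation frequency and [gamma e]. *)
Lemma mean_activation n e (X : Omega -> R) : determined_by (history S M n) X ->
  mean P (fun w => ((e \in M n.+1 w) && S e n.+1 w)%:R * X w) =
  gamma e * activation_frequency Act x e * mean P X.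
Proof.
move=> /determined_by_factor[c ->].
pose G w := (history S M n w, (M n.+1 w, S e n.+1 w)).
have mM : measurable_fibers (M n.+1).
  by move=> m; exact: (measurable_slot_event (fun _ _ => true) (fun=> m) (inr n)).
have mSe : measurable_fibers (S e n.+1).
  by move=> b; exact: (measurable_slot_event (fun _ _ => b) (fun=> finset.set0) (inl (e, n))).
have mH := measurable_fibers_history n.
have mG : measurable_fibers G.
  by apply: measurable_fibers_pair => //; exact: measurable_fibers_pair.
have fH h : P (history S M n @^-1` [set h]) \is a fin_num by exact: fin_num_measure.
have fM m : P (M n.+1 @^-1` [set m]) \is a fin_num by exact: fin_num_measure.
have fS b : P (S e n.+1 @^-1` [set b]) \is a fin_num by exact: fin_num_measure.
rewrite [X in mean P X](_ : _ =
    (fun g : _ * (action N * bool) => ((e \in g.2.1) && g.2.2)%:R * c g.1) \o G)//.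
rewrite !mean_factor//.
pose pH h := c h * fine (P (history S M n @^-1` [set h])).
pose pM (m : action N) := (e \in m)%:R * fine (P (M n.+1 @^-1` [set m])).
pose pS (b : bool) := b%:R * fine (P (S e n.+1 @^-1` [set b])).
rewrite (eq_bigr (fun g => pH g.1 * (pM g.2.1 * pS g.2.2))); last first.
  move=> [h [m b]] _ /=; rewrite history_slot_independent !fineM ?fin_numM ?fH ?fM ?fS//.
  by rewrite /pH /pM /pS -mulnb natrM; lra.
rewrite -(pair_bigA _ (fun h q => pH h * (pM q.1 * pS q.2))) /=.
rewrite -big_distrlr /= mulrC; congr (_ * _).
rewrite -(pair_bigA _ (fun m b => pM m * pS b)) /=.
rewrite -big_distrlr /= activation_probability mulrC; congr (_ * _).
rewrite /pS big_bool /= mul0r addr0 mul1r.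
by rewrite (_ : _ @^-1` _ = [set w | S e n.+1 w = true])// (channel_prob hS).
Qed.

End History.

(** * Bounds on the ages and convergence of their means *)

Section Ages.
Context {R : realType} {d : measure_display} {Omega : measurableType d}.
Context {P : probability Omega R} {N : nat} {gamma : link N -> R}.
Context {Act : {set action N}} {x : action N -> R}.
Context {S : link N -> nat -> Omega -> bool} {M : nat -> Omega -> action N}.
Context {a0 : nat -> R} {A : nat -> nat -> Omega -> R}.
Context (hS : channel_process P gamma S).
Context (hM : action_process P Act x M).
Context (hindep : mutually_independent P (slot_sigma S M)).
Context (hA : age_process S M a0 A).

Lemma age_determined n j : (j < N)%N ->
  determined_by (history S M n) (A j.+1 n.+1).
Proof.
elim: n j => [|n IH] [|j] jN w w' E; rewrite ?(age_source hA)//.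
  by rewrite !(age_init hA).
have jl : (j < N.-1)%N by rewrite -ltnS prednK// (leq_trans _ jN).
have E' : history S M n w = history S M n w'.
  by move/historyP : E => E; apply/historyP => k kn; apply: E; exact: ltnW.
have [ES EM] := (proj1 (historyP _ _ _) E) n (ltnSn n).
have := age_step hA (Ordinal jl); rewrite /link_dst /link_src /= => step.
by rewrite (step n.+1 w)// (step n.+1 w')// ES EM (IH _ jN _ _ E') (IH j (ltnW jN) _ _ E').
Qed.

Lemma simple_variable_age n j : (j < N)%N -> simple_variable (A j.+1 n.+1).
Proof.
move=> jN; eexists; exists (history S M n); split.
  exact: (measurable_fibers_history hS hM).
exact: age_determined.
Qed.

Lemma age_growth j n w : (j < N)%N -> A j.+1 n.+2 w <= A j.+1 n.+1 w + 1.
Proof.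
case: j => [|j] jN; first by rewrite !(age_source hA)// add0r.
have jl : (j < N.-1)%N by rewrite -ltnS prednK// (leq_trans _ jN).
have := age_step hA (Ordinal jl); rewrite /link_dst /link_src /= => ->//.
by case: ifP => _; rewrite lerD2r// ge_min lexx.
Qed.

(* The summand 1 makes [a0 j + n + age_bound >= n.+1], so that [age_gap_le] holds from the
   first slot on whatever the signs of the initial ages. *)
Definition age_bound : R := 1 + \sum_(i < N) `|a0 i.+1|.

Lemma initial_age_bound j : (j < N)%N -> `|a0 j.+1| + 1 <= age_bound.
Proof.
move=> jN; rewrite /age_bound addrC lerD2l (bigD1 (Ordinal jN))//= lerDl.
exact: sumr_ge0.
Qed.

Lemma age_bound_ge1 : 1 <= age_bound.
Proof. by rewrite lerDl; exact: sumr_ge0. Qed.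

(** Initial ages may be negative; neither taking a minimum nor adding 1 can bring an age below a
    common lower bound. *)
Lemma age_ge j n w : (j < N)%N -> - age_bound <= A j.+1 n.+1 w.
Proof.
have c1 := age_bound_ge1.
elim: n j => [|n IH] [|j] jN; rewrite ?(age_source hA)//; try lra.
  rewrite (age_init hA)//; have := initial_age_bound (j.+1) jN.
  have := ler_norm (- a0 j.+2); rewrite normrN; lra.
have jl : (j < N.-1)%N by rewrite -ltnS prednK// (leq_trans _ jN).
have := age_step hA (Ordinal jl); rewrite /link_dst /link_src /= => ->//.
have := IH _ jN; have := IH _ (ltnW jN).
by case: ifP => _ h1 h2; [case: (leP (A j.+2 n.+1 w) (A j.+1 n.+1 w))|]; lra.
Qed.

Lemma age_le j n w : (j < N)%N -> A j.+1 n.+1 w <= age_bound + n%:R.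
Proof.
move=> jN; elim: n => [|n IH]; last first.
  by have := age_growth j n w jN; rewrite -natr1; lra.
case: j jN => [|j] jN; first by rewrite (age_source hA)//; have := age_bound_ge1; lra.
rewrite (age_init hA)//; have := initial_age_bound (j.+1) jN.
by have := ler_norm (a0 j.+2); lra.
Qed.

(** Once a node is no fresher than its predecessor, it stays so: it ages by one or takes the
    predecessor's age plus one, while the predecessor ages by at most one. A node strictly fresher
    now has thus always been so, and every minimum it took was its own age. *)
Lemma age_initial_of_lt_predecessor j n w : (j.+1 < N)%N ->
  A j.+2 n.+1 w < A j.+1 n.+1 w -> A j.+2 n.+1 w = a0 j.+2 + n%:R.
Proof.
move=> jN; have jl : (j < N.-1)%N by rewrite -ltnS prednK// (leq_trans _ jN).
have := age_step hA (Ordinal jl); rewrite /link_dst /link_src /= => step.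
elim: n => [|n IH]; first by rewrite (age_init hA)// addr0.
have := age_growth j n w (ltnW jN).
have [lt _ _|le] := ltP (A j.+2 n.+1 w) (A j.+1 n.+1 w).
  rewrite step//; case: ifP => _; rewrite ?(min_l (ltW lt)) (IH lt) -natr1 addrA//.
by rewrite step// (min_r le) => ?; case: ifP => _; lra.
Qed.

(** The gap is positive only if the node still has age [a0 j.+2 + n]. It is then at most twice
    [age_bound], and the larger predecessor age makes the factor
    [n.+1%:R^-1 * (A j.+1 n.+1 w + age_bound)] at least 1. That factor plays the role of the
    indicator in Markov's inequality. *)
Lemma age_gap_le j n w : (j.+1 < N)%N ->
  A j.+1 n.+1 w - Num.min (A j.+2 n.+1 w) (A j.+1 n.+1 w) <=
  age_bound *+ 2 * (n.+1%:R^-1 * (A j.+1 n.+1 w + age_bound)).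
Proof.
move=> jN; have c1 := age_bound_ge1.
have lo := age_ge j n w (ltnW jN).
have [lt|le] := ltP (A j.+2 n.+1 w) (A j.+1 n.+1 w); last first.
  by rewrite subrr !mulr_ge0 ?invr_ge0//; lra.
have E := age_initial_of_lt_predecessor j n w jN lt.
have := initial_age_bound _ jN; have := ler_norm (- a0 j.+2); rewrite normrN => h1 h2.
apply: (@le_trans _ _ (age_bound *+ 2)).
  by have := age_le j n w (ltnW jN); rewrite E; lra.
rewrite ler_peMr//; first lra.
rewrite mulrC ler_pdivlMr ?ltr0n// mul1r -natr1; lra.
Qed.

Lemma mean_age_cvg j (hp : forall e, 0 < gamma e * activation_frequency Act x e <= 1) :
  (j < N)%N ->
  (fun n => mean P (A j.+1 n.+1)) @ \oo -->
  \sum_(e : link N | (e < j)%N) (gamma e * activation_frequency Act x e)^-1.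
Proof.
elim: j => [|j IH] jN.
  rewrite big_pred0//; under eq_fun do
    (under [X in mean _ X]eq_fun do rewrite (age_source hA)//; rewrite mean_cst).
  exact: cvg_cst.
have {}IH := IH (ltnW jN).
have jl : (j < N.-1)%N by rewrite -ltnS prednK// (leq_trans _ jN).
pose e : link N := Ordinal jl; pose p := gamma e * activation_frequency Act x e.
have := age_step hA e; rewrite /link_dst /link_src /= => step.
have sX n := simple_variable_age n _ jN.
have sY n := simple_variable_age n _ (ltnW jN).
have sZ n := simple_variable_comp2 Num.min _ _ (sX n) (sY n).
pose D n w := A j.+1 n.+1 w - Num.min (A j.+2 n.+1 w) (A j.+1 n.+1 w).
have sD n : simple_variable (D n) := simple_variable_comp2 (fun y z => y - z) _ _ (sY n) (sZ n).
have D0 : (fun n => mean P (D n)) @ \oo --> (0 : R).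
  have ub n : 0 <= mean P (D n) <=
      age_bound *+ 2 * (harmonic n * (mean P (A j.+1 n.+1) + age_bound)).
    apply/andP; split.
      by apply: mean_ge0 => w; rewrite subr_ge0 ge_min lexx orbT.
    have sYc := simple_variable_comp2 +%R _ _ (sY n) (simple_variable_cst age_bound).
    rewrite -[X in _ + X](mean_cst P) -meanD//; last exact: simple_variable_cst.
    have sk := simple_variable_comp ( *%R (harmonic n)) _ sYc.
    rewrite -!meanZ//; apply: ler_mean => //.
      exact: (simple_variable_comp ( *%R (age_bound *+ 2)) _ sk).
    by move=> w; exact: age_gap_le.
  (* By induction the mean age of the predecessor converges, so its product with the harmonic
     sequence vanishes. *)
  apply: (@squeeze_cvgr _ _ _ _ (cst 0)); [exact: nearW ub|exact: cvg_cst|].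
  rewrite -[X in _ --> X](mulr0 (age_bound *+ 2)); apply: cvgMr.
  rewrite -[X in _ --> X](mul0r (\sum_(e : link N | (e < j)%N)
    (gamma e * activation_frequency Act x e)^-1 + age_bound)).
  apply: cvgM; first exact: cvg_harmonic.
  by apply: cvgD => //; exact: cvg_cst.
have p0 : p != 0 by have /andP[/lt0r_neq0] := hp e.
(* The mean of the minimum is written as the predecessor's mean age minus the vanishing mean gap,
   which makes the forcing term convergent. *)
apply: (@cvg_affine_recurrence _ p _ _
    (fun n => 1 + p * (mean P (A j.+1 n.+1) - mean P (D n)))); [exact: hp| |].
  move=> n; pose B w := ((e \in M n.+1 w) && S e n.+1 w).
  pose G w := A j.+2 n.+1 w - Num.min (A j.+2 n.+1 w) (A j.+1 n.+1 w).
  have dG : determined_by (history S M n) G.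
    by move=> w w' E; rewrite /G (age_determined _ _ jN _ _ E)
      (age_determined _ _ (ltnW jN) _ _ E).
  have sG : simple_variable G := simple_variable_comp2 (fun y z => y - z) _ _ (sX n) (sZ n).
  have mG : mean P G = mean P (A j.+2 n.+1) - mean P (A j.+1 n.+1) + mean P (D n).
    by rewrite (meanB P _ _ (sX n) (sZ n)) (meanB P _ _ (sY n) (sZ n)); lra.
  (* The recursion in additive form: a delivery, indicated by [B], lowers the age by [G]. As [G] is
     determined by the history, [mean_activation] evaluates the mean of the product. *)
  have EX : A j.+2 n.+2 \+ (fun w => (B w)%:R * G w) = A j.+2 n.+1 \+ cst 1.
    apply/funext => w /=; rewrite step// -/(B w) /G.
    by case: (B w); rewrite /= ?mul1r ?mul0r; lra.
  have sBG : simple_variable (fun w => (B w)%:R * G w).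
    (* The identity [EX] itself exhibits the product as a combination of ages, hence as simple. *)
    rewrite (_ : (fun w => _) = (fun w => A j.+2 n.+1 w + 1 - A j.+2 n.+2 w)); last first.
      by apply/funext => w; move/(congr1 (@^~ w)) : EX => /=; lra.
    apply: (simple_variable_comp2 (fun y z => y + 1 - z)) => //; exact: sX.
  have := congr1 (mean P) EX.
  rewrite (meanD P _ _ (sX n.+1) sBG) (meanD P _ _ (sX n) (simple_variable_cst 1)).
  rewrite (mean_activation hS hM hindep _ _ _ dG) mean_cst mG -/p; lra.
rewrite (bigD1 e)//= (eq_bigl (fun i : link N => (i < j)%N)); last first.
  move=> i; rewrite ltnS (leq_eqVlt i j) -(inj_eq val_inj) /=.
  by case: (ltngtP i j).
rewrite mulrDr mulfV// -/p; apply: cvgD; first exact: cvg_cst.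
apply: cvgMr; rewrite -[X in _ --> X]subr0; exact: cvgB.
Qed.

End Ages.

(** * From mean ages to the time average *)

Theorem theorem1 (R : realType) (d : measure_display) (Omega : measurableType d)
    (P : probability Omega R) (N : nat) (hN : (2 <= N)%N)
    (gamma : link N -> R) (hgamma : forall e, 0 < gamma e <= 1)
    (Act : {set action N}) (x : action N -> R)
    (hx0 : forall m, m \in Act -> 0 <= x m)
    (hx1 : \sum_(m in Act) x m = 1)
    (hf : forall e, 0 < activation_frequency Act x e)
    (S : link N -> nat -> Omega -> bool) (M : nat -> Omega -> action N)
    (hS : channel_process P gamma S)
    (hM : action_process P Act x M)
    (hindep : mutually_independent P (slot_sigma S M))
    (a0 : nat -> R) (A : nat -> nat -> Omega -> R)
    (hA : age_process S M a0 A) :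
  (fun T : nat =>
     'E_P[fun w => (T%:R^-1 * \sum_(1 <= t < T.+1) A N t w)%R])%E @ \oo
    --> (\sum_(e : link N) (gamma e * activation_frequency Act x e)^-1)%:E.
Proof.
have hp e : 0 < gamma e * activation_frequency Act x e <= 1.
  have /andP[g0 g1] := hgamma e; rewrite mulr_gt0//= mulr_ile1//; try exact: ltW.
  rewrite -hx1 /activation_frequency [leRHS](bigID (fun m : action N => e \in m))/= lerDl.
  by apply: sumr_ge0 => m /andP[/hx0].
have Npos : (0 < N)%N by exact: ltn_trans hN.
have pN : (N.-1 < N)%N by rewrite prednK.
have := cesaro (mean_age_cvg hS hM hindep hA _ hp pN).
rewrite prednK// (eq_bigl xpredT) => [|e]; last exact: ltn_ord.
(* The Cesaro mean of index [n] averages [n + 1] terms; the shift makes it the average over slots 1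
   to [T]. *)
rewrite (cvg_shiftS (fun n => n%:R^-1 * series (fun n => mean P (A N n.+1)) n)) => lim.
have sA n : simple_variable (A N n.+1).
  by have := simple_variable_age hS hM hA n _ pN; rewrite prednK.
rewrite [X in X @ \oo --> _](_ : _ =
    (fun T => (T%:R^-1 * series (fun n => mean P (A N n.+1)) T)%:E)).
  by apply: cvg_EFin => //; exact: nearW.
apply/funext => T; under [X in expectation _ X]eq_fun do rewrite big_add1 /=.
have sSum : simple_variable (fun w => \sum_(0 <= n < T) A N n.+1 w).
  exact: simple_variable_sum.
rewrite expectation_mean; last exact: (simple_variable_comp ( *%R T%:R^-1) _ sSum).
by rewrite meanZ// mean_sum.
Qed.
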